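(* Let $Q=Q_0+sQ_1$ with $Q_0,Q_1\in\mathbb{H}[t]$ and $Q_1$ monic, let $\gcd(Q)=1$, and suppose $QQ^\ast=PR$ with $P\in\mathbb{R}[t]$ and $R\in\mathbb{R}[s]$. If $[Q_0(z)]\vee[Q_1(z)]$ is a straight line for all zeros $z\in\mathbb{C}$ of $P$, then $|\mathrm{Fact}(Q)|=1$.
   Context: $\mathbb{H}$ is the skew field of real quaternions with units $\mathbf{i},\mathbf{j},\mathbf{k}$; $\mathbb{H}[t,s]$ is the ring of polynomials in which $t,s$ commute with each other and with all coefficients. $Q^\ast$ is obtained by conjugating all coefficients. $\gcd(Q)$ is the monic greatest common divisor in $\mathbb{R}[t,s]$ of the four real coordinate polynomials of $Q$ with respect to $1,\mathbf{i},\mathbf{j},\mathbf{k}$. $\mathbb{C}\mathbb{H}=\mathbb{C}\otimes_{\mathbb{R}}\mathbb{H}$ is the algebra of complex quaternions (complex scalars commute with $\mathbf{i},\mathbf{j},\mathbf{k}$). For $z\in\mathbb{C}$, $Q_\ell(z)\in\mathbb{C}\mathbb{H}$ is obtained by substituting $t=z$. $[q]$ denotes the point of $\mathbb{P}(\mathbb{C}\mathbb{H})=\mathbb{P}^3(\mathbb{C})$ represented by $q\ne0$. $[Q_0(z)]\vee[Q_1(z)]$ denotes the projective span of $Q_0(z)$ and $Q_1(z)$; it is a straight line if $Q_0(z),Q_1(z)$ are linearly independent over $\mathbb{C}$, and a point if they are linearly dependent (in particular if one of them is $0$; both being zero is impossible when $\gcd(Q)=1$). $\mathrm{fact}(Q)$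 is the set of all factorizations $Q=(t-h_1)\cdots(t-h_n)(s-h)(t-k_1)\cdots(t-k_m)$ with $n,m\ge0$ and $h_i,h,k_j\in\mathbb{H}$ (an element is the tuple of linear factors; empty products equal $1$). Two elements of $\mathrm{fact}(Q)$ with left $t$-factors $t-h_1,\dots,t-h_n$ and $t-\hat h_1,\dots,t-\hat h_l$ (the factors to the left of the $s$-factor) are equivalent if $\prod_{i=1}^{n}(t-h_i)(t-h_i)^\ast=\prod_{i=1}^{l}(t-\hat h_i)(t-\hat h_i)^\ast$. $\mathrm{Fact}(Q)$ is the set of equivalence classes. *)

(* Defs.v *)
From HB Require Import structures.
From mathcomp Require Import all_boot all_order all_algebra.
From mathcomp Require Import complex ring.
From mathcomp Require Import boolp classical_sets functions cardinality reals.

Set Implicit Arguments.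
Unset Strict Implicit.
Unset Printing Implicit Defensive.

Import Order.TTheory GRing.Theory Num.Theory.

Local Open Scope ring_scope.

(* Hamilton's quaternions over an arbitrary commutative ring K.  For a real    *)
(* field R, quat R is the skew field of real quaternions and quat R[i] is the  *)
(* algebra of complex quaternions, i.e. the scalar extension of quat R to R[i] *)
(* along the coordinatewise inclusion map_quat (real_complex R).               *)
Record quat (K : Type) := Quat { qre : K; qi : K; qj : K; qk : K }.

Section QuatChoice.
Variable K : Type.
Definition quat_enc (x : quat K) := (qre x, qi x, qj x, qk x).
Definition quat_dec (x : K * K * K * K) :=
  let: (a, b, c, d) := x in Quat a b c d.
Lemma quat_encK : cancel quat_enc quat_dec.
Proof. by case. Qed.
End QuatChoice.

HB.instance Definition _ (K : eqType) :=
  Equality.copy (quat K) (can_type (@quat_encK K)).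
HB.instance Definition _ (K : choiceType) :=
  Choice.copy (quat K) (can_type (@quat_encK K)).

Definition map_quat (K L : Type) (f : K -> L) (x : quat K) : quat L :=
  Quat (f (qre x)) (f (qi x)) (f (qj x)) (f (qk x)).

Section QuatRing.
Variable K : comNzRingType.
Implicit Types x y z : quat K.

Definition quat_zero : quat K := Quat 0 0 0 0.
Definition quat_opp x := Quat (- qre x) (- qi x) (- qj x) (- qk x).
Definition quat_add x y :=
  Quat (qre x + qre y) (qi x + qi y) (qj x + qj y) (qk x + qk y).

Lemma quat_addA : associative quat_add.
Proof. by move=> x y z; congr Quat; exact: addrA. Qed.
Lemma quat_addC : commutative quat_add.
Proof. by move=> x y; congr Quat; exact: addrC. Qed.
Lemma quat_add0 : left_id quat_zero quat_add.
Proof. by case=> a b c d; congr Quat; exact: add0r. Qed.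
Lemma quat_addN : left_inverse quat_zero quat_opp quat_add.
Proof. by case=> a b c d; congr Quat; exact: addNr. Qed.

HB.instance Definition _ := GRing.isZmodule.Build (quat K)
  quat_addA quat_addC quat_add0 quat_addN.

Definition quat_one : quat K := Quat 1 0 0 0.
Definition quat_mul x y :=
  let: Quat a b c d := x in let: Quat a' b' c' d' := y in
  Quat (a * a' - b * b' - c * c' - d * d')
       (a * b' + b * a' + c * d' - d * c')
       (a * c' - b * d' + c * a' + d * b')
       (a * d' + b * c' - c * b' + d * a').

Lemma quat_mulA : associative quat_mul.
Proof. by move=> [? ? ? ?] [? ? ? ?] [? ? ? ?]; congr Quat; ring. Qed.
Lemma quat_mul1 : left_id quat_one quat_mul.
Proof. by case=> * /=; congr Quat; ring. Qed.
Lemma quat_mulr1 : right_id quat_one quat_mul.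
Proof. by case=> * /=; congr Quat; ring. Qed.
Lemma quat_mulDl : left_distributive quat_mul +%R.
Proof. by move=> [? ? ? ?] [? ? ? ?] [? ? ? ?]; congr Quat => /=; ring. Qed.
Lemma quat_mulDr : right_distributive quat_mul +%R.
Proof. by move=> [? ? ? ?] [? ? ? ?] [? ? ? ?]; congr Quat => /=; ring. Qed.
Lemma quat_one_neq0 : quat_one != 0.
Proof. by apply/eqP; case=> /eqP; rewrite oner_eq0. Qed.

HB.instance Definition _ := GRing.Zmodule_isNzRing.Build (quat K)
  quat_mulA quat_mul1 quat_mulr1 quat_mulDl quat_mulDr quat_one_neq0.

Definition quat_scale (a : K) x :=
  Quat (a * qre x) (a * qi x) (a * qj x) (a * qk x).

Lemma quat_scaleA a b x : quat_scale a (quat_scale b x) = quat_scale (a * b) x.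
Proof. by congr Quat; exact: mulrA. Qed.
Lemma quat_scale1 : left_id 1 quat_scale.
Proof. by case=> * ; congr Quat; exact: mul1r. Qed.
Lemma quat_scaleDr : right_distributive quat_scale +%R.
Proof. by move=> a x y; congr Quat; exact: mulrDr. Qed.
Lemma quat_scaleDl x : {morph quat_scale^~ x : a b / a + b}.
Proof. by move=> a b; congr Quat; exact: mulrDl. Qed.

HB.instance Definition _ := GRing.Zmodule_isLmodule.Build K (quat K)
  quat_scaleA quat_scale1 quat_scaleDr quat_scaleDl.

Lemma quat_scaleAl (a : K) x y : a *: (x * y) = (a *: x) * y.
Proof. by move: x y => [? ? ? ?] [? ? ? ?]; congr Quat => /=; ring. Qed.
HB.instance Definition _ := GRing.Lmodule_isLalgebra.Build K (quat K)
  quat_scaleAl.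

Lemma quat_scaleAr (a : K) x y : a *: (x * y) = x * (a *: y).
Proof. by move: x y => [? ? ? ?] [? ? ? ?]; congr Quat => /=; ring. Qed.
HB.instance Definition _ := GRing.Lalgebra_isAlgebra.Build K (quat K)
  quat_scaleAr.

Definition quat_row x : 'rV[K]_4 :=
  \row_(i < 4) [:: qre x; qi x; qj x; qk x]`_i.
Lemma quat_row_vect : Vector.axiom 4 (quat K).
Proof.
exists quat_row.
  move=> a x y; apply/rowP => i; rewrite !mxE.
  by case: i => -[|[|[|[|]]]].
exists (fun v : 'rV[K]_4 =>
  Quat (v 0 0) (v 0 1) (v 0 (inord 2)) (v 0 (inord 3))).
  by case=> a b c d; rewrite /quat_row !mxE !inordK.
move=> v; apply/rowP => i; rewrite !mxE.
by case: i => -[|[|[|[|]]]] //= lti; congr (v 0 _); apply/val_inj;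
  rewrite /= ?inordK.
Qed.
HB.instance Definition _ := Lmodule_hasFinDim.Build K (quat K) quat_row_vect.

Definition quat_conj x := Quat (qre x) (- qi x) (- qj x) (- qk x).

End QuatRing.

(* A bivariate polynomial ring K[t,s] is represented as {poly {poly K}}: the   *)
(* inner variable is t, the outer one is s.                                    *)

Definition coordt (K : comNzRingType) (f : quat K -> K) :
  {poly {poly (quat K)}} -> {poly {poly K}} := map_poly (map_poly f).

Definition quat_coords (K : comNzRingType) (Q : {poly {poly (quat K)}}) :
  seq {poly {poly K}} :=
  [:: coordt (@qre K) Q; coordt (@qi K) Q; coordt (@qj K) Q; coordt (@qk K) Q].

Definition conjt (K : comNzRingType) (p : {poly (quat K)}) : {poly (quat K)} :=
  map_poly (@quat_conj K) p.

Definition conjts (K : comNzRingType) (Q : {poly {poly (quat K)}}) :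
  {poly {poly (quat K)}} := map_poly (@conjt K) Q.

(* Genuine divisibility in K[t,s]: the library's %| for {poly {poly K}} tests  *)
(* pseudo-divisibility, which ignores factors in K[t].                         *)
Definition dvdts (K : comNzRingType) (d p : {poly {poly K}}) : Prop :=
  exists e, p = e * d.

(* The monic gcd in K[t,s]; monic refers to the lexicographic order s > t.     *)
Definition is_monic_gcd (K : comNzRingType) (ps : seq {poly {poly K}})
    (g : {poly {poly K}}) : Prop :=
  [/\ lead_coef g \is monic,
      forall p, p \in ps -> dvdts g p &
      forall d, (forall p, p \in ps -> dvdts d p) -> dvdts d g].

Definition is_gcdts (K : comNzRingType) (Q : {poly {poly (quat K)}}) :=
  is_monic_gcd (quat_coords Q).

Definition emb_t (K : comNzRingType) (P : {poly K}) : {poly {poly (quat K)}} :=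
  (map_poly (in_alg (quat K)) P)%:P.

Definition emb_s (K : comNzRingType) (S : {poly K}) : {poly {poly (quat K)}} :=
  map_poly (fun a : K => (a%:A)%:P : {poly (quat K)}) S.

(* The value at t = z of a polynomial with real quaternion coefficients; z is  *)
(* central in quat R[i], so the side on which powers of z stand is immaterial. *)
Definition ceval (R : realType) (q : {poly (quat R)}) (z : R[i]) : quat R[i] :=
  (map_poly (map_quat (real_complex R)) q).[z%:A].

(* [q0] \/ [q1] is the projectivization of the linear span of q0 and q1; it is *)
(* a straight line iff that span has dimension 2 over the complex numbers.     *)
Definition join_is_line (R : realType) (q0 q1 : quat R[i]) : Prop :=
  \dim (<[q0]> + <[q1]>)%VS = 2%N.

Section Factorizations.
Variable R : realType.
Local Notation H := (quat R).
Local Open Scope classical_set_scope.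

Definition tfactor (h : H) : {poly {poly H}} := ('X - h%:P)%:P.
Definition sfactor (h : H) : {poly {poly H}} := 'X - (h%:P)%:P.

(* (hs, h, ks): left t-factors, s-factor, right t-factors.                     *)
Definition factorization : Type := seq H * H * seq H.

Definition fact_prod (f : factorization) : {poly {poly H}} :=
  let: (hs, h, ks) := f in
  (\prod_(x <- hs) tfactor x) * sfactor h * (\prod_(x <- ks) tfactor x).

Definition fact (Q : {poly {poly H}}) : set factorization :=
  [set f | Q = fact_prod f].

Definition left_norm (f : factorization) : {poly H} :=
  \prod_(x <- f.1.1) (('X - x%:P) * conjt ('X - x%:P)).

Definition fact_equiv (f g : factorization) : Prop := left_norm f = left_norm g.

Definition fact_class (Q : {poly {poly H}}) (f : factorization) :
  set factorization := [set g | fact Q g /\ fact_equiv f g].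

Definition fact_classes (Q : {poly {poly H}}) : set (set factorization) :=
  [set fact_class Q f | f in fact Q].

End Factorizations.

(* Main.v *)
Require Import Defs.
From HB Require Import structures.
From mathcomp Require Import all_boot all_order all_algebra.
From mathcomp Require Import complex ring.
From mathcomp Require Import boolp classical_sets functions cardinality reals.

Set Implicit Arguments.
Unset Strict Implicit.
Unset Printing Implicit Defensive.

Import Order.TTheory GRing.Theory Num.Theory.

Local Open Scope ring_scope.

(* Let N(F) = F F^*. Comparing coefficients of s in Q Q^* = P R shows that,    *)
(* at a zero z of N(Q1), q0 = Q0(z) and q1 = Q1(z) span a line in the quadric  *)
(* of null complex quaternions. This line lies in one of the two rulings:      *)
(* q0^* q1 = 0 or q0 q1^* = 0. In the first case Q0 and Q1 share a left linear *)
(* factor t - h with N(t - h)(z) = 0, in the second a right one. Splitting it  *)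
(* off preserves the hypotheses, so induction on deg Q1 gives a factorization. *)
(* For factorizations Q = A (s - h) B = A' (s - h') B', the polynomials N(A)   *)
(* and N(B') have no common complex zero z: the line through q0, q1 would lie  *)
(* in both rulings. As N(A) N(B) = N(A') N(B'), N(A) and N(A') divide each     *)
(* other.                                                                      *)

(** The points of a line on the null quadric share a nonzero left annihilator or a nonzero right
    one, according to its ruling ([null_line_ruling]). Over a zero [z], a left annihilator lifts to
    a common left linear factor of [Q0] and [Q1] ([common_left_linear_factor]), a right one to a
    right factor by conjugation; [exists_splitting] peels these off until [Q1] is 1 and [Q0] is
    constant, which yields the s-factor. For uniqueness, elements annihilated from both sides are
    proportional ([annihilators_collinear]), so where the join is a straight line the left norm of
    one factorization and the right norm of another cannot both vanish. Hence [Q] determines the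
    left norm ([left_norm_unique]). *)

Section QuaternionCoordinates.
Variable K : comNzRingType.

Lemma quat_addE (a b c d a' b' c' d' : K) :
  Quat a b c d + Quat a' b' c' d' = Quat (a + a') (b + b') (c + c') (d + d').
Proof. by []. Qed.

Lemma quat_mulE (a b c d a' b' c' d' : K) : Quat a b c d * Quat a' b' c' d' =
  Quat (a * a' - b * b' - c * c' - d * d') (a * b' + b * a' + c * d' - d * c')
       (a * c' - b * d' + c * a' + d * b') (a * d' + b * c' - c * b' + d * a').
Proof. by []. Qed.

Lemma quat_oppE (a b c d : K) : - Quat a b c d = Quat (- a) (- b) (- c) (- d).
Proof. by []. Qed.

Lemma quat_scaleE (a b c d e : K) :
  e *: Quat a b c d = Quat (e * a) (e * b) (e * c) (e * d).
Proof. by []. Qed.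

Lemma quat_conjE (a b c d : K) :
  quat_conj (Quat a b c d) = Quat a (- b) (- c) (- d).
Proof. by []. Qed.

Lemma quat_oneE : 1 = Quat 1 0 0 0 :> quat K.
Proof. by []. Qed.

Definition quatE :=
  (quat_oneE, quat_addE, quat_oppE, quat_mulE, quat_scaleE, quat_conjE).

End QuaternionCoordinates.

Ltac quat_ring := rewrite ?quatE; congr Quat; rewrite /=; ring.

(** * Conjugation, norm and trace of quaternions *)

Section Quaternions.
Variable K : comNzRingType.
Implicit Types x y z : quat K.

Fact quat_conj_is_zmod_morphism : zmod_morphism (@quat_conj K).
Proof. by move=> [? ? ? ?] [? ? ? ?]; quat_ring. Qed.
HB.instance Definition _ := GRing.isZmodMorphism.Build (quat K) (quat K)
  (@quat_conj K) quat_conj_is_zmod_morphism.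

Lemma quat_conjK : involutive (@quat_conj K).
Proof. by case=> *; quat_ring. Qed.

Lemma quat_conjD : {morph @quat_conj K : x y / x + y}.
Proof. exact: raddfD. Qed.

Lemma quat_conjM x y : quat_conj (x * y) = quat_conj y * quat_conj x.
Proof. by case: x => *; case: y => *; quat_ring. Qed.

Lemma quat_conj1 : quat_conj 1 = 1 :> quat K.
Proof. by quat_ring. Qed.

Lemma quat_conj_alg a : quat_conj a%:A = a%:A :> quat K.
Proof. by quat_ring. Qed.

Lemma quat_algC a x : a%:A * x = x * a%:A.
Proof. by case: x => *; quat_ring. Qed.

Definition qnorm x : K := qre x ^+ 2 + qi x ^+ 2 + qj x ^+ 2 + qk x ^+ 2.

Lemma mul_quat_conj x : x * quat_conj x = (qnorm x)%:A.
Proof. by case: x => *; rewrite /qnorm; quat_ring. Qed.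

Lemma mul_conj_quat x : quat_conj x * x = (qnorm x)%:A.
Proof. by case: x => *; rewrite /qnorm; quat_ring. Qed.

Lemma qreC x y : qre (x * y) = qre (y * x).
Proof. by case: x => *; case: y => *; rewrite !quatE /=; ring. Qed.

Lemma addr_quat_conj x : x + quat_conj x = (qre x *+ 2)%:A.
Proof. by case: x => *; quat_ring. Qed.

Lemma mulr_null x y : x * quat_conj x = 0 -> x * y * x = qre (x * y) *+ 2 *: x.
Proof.
move=> x0; rewrite -mulr_algl -addr_quat_conj mulrDl quat_conjM.
by rewrite -(mulrA (quat_conj y)) mul_conj_quat -mul_quat_conj x0 mulr0 addr0.
Qed.

End Quaternions.

(** * The null quadric and its two rulings *)

Section QuaternionsField.
Variable K : numFieldType.
Implicit Types x y z : quat K.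

Lemma quat_alg_eq0 (a : K) : (a%:A == 0 :> quat K) = (a == 0).
Proof. by rewrite scaler_eq0 oner_eq0 orbF. Qed.

(** The trace form is nondegenerate, as testing against the four units shows. For null [x],
    [mulr_null] makes [x * y] an idempotent. *)
Lemma qre_nondegenerate x : x != 0 -> exists y, qre (x * y) *+ 2 = 1.
Proof.
move=> x0; suff [y xy0] : exists y, qre (x * y) != 0.
  exists ((qre (x * y) *+ 2)^-1 *: y).
  rewrite -scalerAr -[qre (_ *: _)]/(_ * qre _) -mulrnAr mulVf //.
  by rewrite mulrn_eq0.
apply: contrapT => /forallNP H; case/eqP: x0.
have {}H y : qre (x * y) = 0 by apply/eqP/negbNE/negP/H.
case: x H => a b c d H.
move: (H (Quat 1 0 0 0)) (H (Quat 0 1 0 0)) (H (Quat 0 0 1 0)) (H (Quat 0 0 0 1)).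
rewrite !quatE /= !(mulr0, mulr1, subr0, add0r, sub0r) => -> /eqP + /eqP + /eqP.
by rewrite !oppr_eq0 => /eqP-> /eqP-> /eqP->.
Qed.

(** The two-sided ideal generated by a nonzero [y] contains 1, even when zero divisors exist. *)
Lemma quat_prime x y : (forall z, x * z * y = 0) -> x = 0 \/ y = 0.
Proof.
move=> H; case: (eqVneq y 0) => [|/qre_nondegenerate[w yw]]; [by right|left].
have E : qre (y * w) *+ 2 *: 1 = 1 :> quat K by rewrite yw scale1r.
pose s z : quat K := z * (y * w) * quat_conj z.
have H' z : x * s z = 0 by rewrite /s !mulrA H !mul0r.
(* The sum of e u e^* over the four units e is twice the real trace of u. *)
have: x * (s 1 + s (Quat 0 1 0 0) + s (Quat 0 0 1 0) + s (Quat 0 0 0 1)) = 0.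
  by rewrite !mulrDr !H' !addr0.
have -> : s 1 + s (Quat 0 1 0 0) + s (Quat 0 0 1 0) + s (Quat 0 0 0 1) =
    2 *: (qre (y * w) *+ 2 *: 1).
  by rewrite /s; case: (y * w) => *; quat_ring.
by rewrite E -scalerAr mulr1 => /eqP; rewrite scaler_eq0 pnatr_eq0 => /eqP.
Qed.

(* The hypotheses say that x and y span a line in the null quadric, the        *)
(* alternatives in which of its two rulings this line lies.                    *)
Lemma null_line_ruling x y :
  x * quat_conj x = 0 -> y * quat_conj y = 0 ->
  x * quat_conj y + y * quat_conj x = 0 ->
  x * quat_conj y = 0 \/ quat_conj x * y = 0.
Proof.
move=> x0 y0 /eqP; rewrite addr_eq0 => /eqP xy; apply: quat_prime => z.
have x0' : quat_conj x * quat_conj (quat_conj x) = 0.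
  by rewrite quat_conjK mul_conj_quat -mul_quat_conj.
rewrite xy !mulNr -!mulrA (mulrA z) (mulrA (quat_conj x)).
rewrite [quat_conj x * _]mulrA mulr_null // -scalerAl -scalerAr mulrA.
rewrite -[y * _]opprK -xy.
by rewrite mulNr -mulrA mul_conj_quat -mul_quat_conj y0 mulr0 oppr0 scaler0 oppr0.
Qed.

(** The elements killed by [z] from the left form the right ideal generated by [quat_conj z]. It is
    minimal, so [x] generates it too, and the idempotent [x * w] acts on it as a left identity. *)
Lemma common_left_annihilator x y z w :
  z != 0 -> z * x = 0 -> z * y = 0 -> qre (x * w) *+ 2 = 1 -> y = x * w * y.
Proof.
move=> /qre_nondegenerate[v zv] zx zy xw.
have x0 : x != 0.
  by apply: contra_eq_neq xw => ->; rewrite mul0r mul0rn eq_sym oner_eq0.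
have z0 : quat_conj z * quat_conj (quat_conj z) = 0.
  rewrite mul_quat_conj; apply/eqP; rewrite quat_alg_eq0.
  have /eqP : quat_conj z * z * x = 0 by rewrite -mulrA zx mulr0.
  rewrite mul_conj_quat mulr_algl scaler_eq0 (negPf x0) orbF /qnorm.
  by case: (z) => * /=; rewrite !sqrrN.
(* The choice of [v] means 1 = v z + z^* v^*, and the first summand kills [u]. *)
have E u : z * u = 0 -> u = quat_conj z * (quat_conj v * u).
  move=> zu; rewrite -[LHS]mul1r -[1 in LHS]scale1r -zv qreC -addr_quat_conj.
  by rewrite mulrDl -mulrA zu mulr0 add0r quat_conjM mulrA.
have zK : quat_conj z * (quat_conj v * x * w) * quat_conj z = quat_conj z.
  by rewrite mulr_null // !mulrA -(mulrA (quat_conj z)) -E // xw scale1r.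
rewrite {1}(E y zy) -{1}zK {2}(E x zx) {2}(E y zy).
by rewrite !mulrA.
Qed.

Lemma quat_conj_eq0 x : (quat_conj x == 0) = (x == 0).
Proof. by rewrite -(inj_eq (can_inj (@quat_conjK K))) quat_conjK raddf0. Qed.

(* Lines of opposite rulings meet in a single point of the null quadric. *)
Lemma annihilators_collinear z t x y :
  z != 0 -> t != 0 -> z * x = 0 -> z * y = 0 -> x * t = 0 -> y * t = 0 ->
  x = 0 \/ exists c, y = c *: x.
Proof.
move=> z0 t0 zx zy xt yt; case: (eqVneq x 0) => [|x0]; [by left|right].
have xx : x * quat_conj x = 0.
  apply/eqP; rewrite mul_quat_conj quat_alg_eq0.
  have /eqP : z * (x * quat_conj x) = 0 by rewrite mulrA zx mul0r.
  by rewrite mul_quat_conj mulr_algr scaler_eq0 (negPf z0) orbF.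
have [w xw] := qre_nondegenerate x0.
have y1 := common_left_annihilator z0 zx zy xw.
have /(congr1 (@quat_conj K)) : quat_conj y = quat_conj x * quat_conj w * quat_conj y.
  apply: (@common_left_annihilator _ _ (quat_conj t)).
  - by rewrite quat_conj_eq0.
  - by rewrite -quat_conjM xt raddf0.
  - by rewrite -quat_conjM yt raddf0.
  - by rewrite -quat_conjM -xw (qreC w).
rewrite !quat_conjM !quat_conjK => y2.
(* The two identities combine to y = x (w y w) x, a multiple of the null element [x]. *)
exists (qre (x * (w * y * w)) *+ 2).
by rewrite -mulr_null // {1}y1 {1}y2 !mulrA.
Qed.

End QuaternionsField.

(** * Conjugation and norm of quaternion polynomials *)

Section QuaternionPolynomials.
Variable K : comNzRingType.
Local Notation H := (quat K).
Implicit Types p q : {poly H}.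

Definition real_poly : {poly K} -> {poly H} := map_poly (in_alg H).

HB.instance Definition _ := GRing.RMorphism.on real_poly.
HB.instance Definition _ :=
  GRing.Additive.copy (@conjt K) (map_poly (@quat_conj K)).

Lemma coef_conjt p i : (conjt p)`_i = quat_conj p`_i.
Proof. exact: coef_map. Qed.

Lemma conjtK : involutive (@conjt K).
Proof. by move=> p; apply/polyP=> i; rewrite !coef_conjt quat_conjK. Qed.

Lemma conjtD : {morph @conjt K : p q / p + q}.
Proof. exact: raddfD. Qed.

Lemma conjtM p q : conjt (p * q) = conjt q * conjt p.
Proof.
apply/polyP=> i; rewrite coef_conjt coefM coefMr raddf_sum.
by apply: eq_bigr => j _; rewrite /= quat_conjM !coef_conjt.
Qed.

Lemma conjtC (x : H) : conjt x%:P = (quat_conj x)%:P.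
Proof. by rewrite /conjt map_polyC. Qed.

Lemma conjtX : conjt 'X = 'X :> {poly H}.
Proof.
apply/polyP=> i; rewrite coef_conjt coefX.
by case: eqP; rewrite ?quat_conj1 ?raddf0.
Qed.

Lemma conjtXsubC (x : H) : conjt ('X - x%:P) = 'X - (quat_conj x)%:P.
Proof. by rewrite raddfB /= conjtC conjtX. Qed.

Lemma real_polyC p (a : {poly K}) : real_poly a * p = p * real_poly a.
Proof.
apply/polyP=> i; rewrite coefM coefMr.
by apply: eq_bigr => j _; rewrite !coef_map /= quat_algC.
Qed.

Lemma real_poly_inj : injective real_poly.
Proof.
move=> a b ab; apply/polyP=> i; move/(congr1 (fun p => qre p`_i)): ab.
by rewrite !coef_map /= !mulr1.
Qed.

(* Locked to keep rewriting with mulrA from unfolding the norm. *)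
Definition hnorm p := locked (p * conjt p).

Lemma hnormE p : hnorm p = p * conjt p.
Proof. by rewrite /hnorm -lock. Qed.

Lemma conjt_hnorm p : conjt (hnorm p) = hnorm p.
Proof. by rewrite hnormE conjtM conjtK. Qed.

End QuaternionPolynomials.

Section HermitianNorm.
Variable K : numFieldType.
Local Notation H := (quat K).
Implicit Types p q : {poly H}.

Lemma conjt_fixed p : conjt p = p -> exists a, p = real_poly a.
Proof.
move=> pp; exists (map_poly (@qre K) p); apply/polyP=> i.
rewrite coef_map /= coef_map_id0 //.
move/(congr1 (fun q => q`_i)): pp; rewrite coef_conjt; case: p`_i => a b c d [].
have E x : - x = x -> x = 0 :> K.
  move/eqP; rewrite eq_sym -addr_eq0 -mulr2n -mulr_natl mulf_eq0 pnatr_eq0 /=.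
  by move/eqP.
by move=> /E-> /E-> /E->; quat_ring.
Qed.

Lemma hnorm_real p : exists a, hnorm p = real_poly a.
Proof. by exact/conjt_fixed/conjt_hnorm. Qed.

Lemma hnormC p q : hnorm p * q = q * hnorm p.
Proof. by have [a ->] := hnorm_real p; rewrite real_polyC. Qed.

Lemma conjt_hnormM p q : conjt (hnorm p * q) = hnorm p * conjt q.
Proof. by rewrite (conjtM (hnorm p)) conjt_hnorm hnormC. Qed.

Lemma size_conjt p : size (conjt p) = size p.
Proof.
apply/eqP; rewrite eqn_leq.
suff H q : (size (conjt q) <= size q)%N by rewrite H /= -{1}(conjtK p) H.
by apply/leq_sizeP => j qj; rewrite coef_conjt nth_default // raddf0.
Qed.

Lemma conjt_monic p : p \is monic -> conjt p \is monic.
Proof.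
move=> /monicP; rewrite /lead_coef => p1.
by apply/monicP; rewrite /lead_coef size_conjt coef_conjt p1 quat_conj1.
Qed.

Lemma hnorm_monic p : p \is monic -> hnorm p \is monic.
Proof. by move=> p1; rewrite hnormE (monicMl _ p1) conjt_monic. Qed.

Lemma monic_mulrI p q r : p \is monic -> p * q = p * r -> q = r.
Proof. by move=> /monic_lreg; exact. Qed.

Lemma monic_mulIr p q r : p \is monic -> q * p = r * p -> q = r.
Proof. by move=> /monic_rreg; exact. Qed.

Lemma hnorm_conjt p : p \is monic -> hnorm (conjt p) = hnorm p.
Proof.
move=> p1; apply: (monic_mulrI p1).
by rewrite -(hnormC p p) !hnormE conjtK mulrA.
Qed.

(** Conjugation gives p^* q = p^* p r^*, where p^* cancels. *)
Lemma conj_left_factor p q r :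
  p \is monic -> conjt q * p = hnorm p * r -> q = p * conjt r.
Proof.
move=> p1 /(congr1 (@conjt K)); rewrite conjt_hnormM conjtM conjtK.
have -> : hnorm p = conjt p * p by rewrite -hnorm_conjt // hnormE conjtK.
by rewrite -mulrA => /(monic_mulrI (conjt_monic p1)).
Qed.

Lemma hnormM p q : hnorm (p * q) = hnorm p * hnorm q.
Proof.
by rewrite hnormE conjtM mulrA -(mulrA p) -hnormE -mulrA hnormC mulrA -hnormE.
Qed.

End HermitianNorm.

(** * Evaluation at complex numbers *)

Section ComplexEvaluation.
Variable R : realType.
Local Notation H := (quat R).
Local Notation rc := (real_complex R).
Implicit Types (p q : {poly H}) (z : R[i]).

Fact map_quat_is_zmod_morphism : zmod_morphism (map_quat rc).
Proof. by move=> [? ? ? ?] [? ? ? ?]; rewrite /map_quat !quatE /= !rmorphB. Qed.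
HB.instance Definition _ := GRing.isZmodMorphism.Build H (quat R[i])
  (map_quat rc) map_quat_is_zmod_morphism.
Fact map_quat_is_monoid_morphism : monoid_morphism (map_quat rc).
Proof.
split=> [|[? ? ? ?] [? ? ? ?]]; first by rewrite /map_quat /= rmorph1 !rmorph0.
by rewrite /map_quat !quatE /= !(rmorphB, rmorphD, rmorphM).
Qed.
HB.instance Definition _ := GRing.isMonoidMorphism.Build H (quat R[i])
  (map_quat rc) map_quat_is_monoid_morphism.

Lemma map_quat_conj (x : H) :
  map_quat rc (quat_conj x) = quat_conj (map_quat rc x).
Proof. by case: x => *; rewrite /map_quat /= !rmorphN. Qed.

Lemma map_quat_alg (x : R) : map_quat rc x%:A = (rc x)%:A.
Proof. by rewrite !quatE /map_quat /= !mulr0 !mulr1 rmorph0. Qed.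

Lemma map_quat_eq0 (x : H) : (map_quat rc x == 0) = (x == 0).
Proof.
apply/eqP/eqP=> [|->]; last exact: raddf0.
by case: x => a b c d [-> -> -> ->].
Qed.

Lemma cevalM p q z : ceval (p * q) z = ceval p z * ceval q z.
Proof.
rewrite /ceval rmorphM hornerM_comm // /comm_poly.
exact: quat_algC.
Qed.

Lemma cevalD p q z : ceval (p + q) z = ceval p z + ceval q z.
Proof. by rewrite /ceval rmorphD hornerD. Qed.

Lemma cevalC (x : H) z : ceval x%:P z = map_quat rc x.
Proof. by rewrite /ceval map_polyC hornerC. Qed.

Lemma ceval0 z : ceval 0 z = 0.
Proof. by rewrite -polyC0 cevalC raddf0. Qed.

Lemma cevalX z : ceval 'X z = z%:A.
Proof. by rewrite /ceval map_polyX hornerX. Qed.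

Lemma cevalN p z : ceval (- p) z = - ceval p z.
Proof. by rewrite /ceval raddfN hornerN. Qed.

Lemma ceval_real (a : {poly R}) z :
  ceval (real_poly a) z = ((map_poly rc a).[z])%:A.
Proof.
elim/poly_ind: a => [|a c IHa]; first by rewrite !raddf0 ceval0 horner0 scale0r.
rewrite /real_poly !rmorphD !rmorphM /= !map_polyX !map_polyC -/(real_poly a).
rewrite cevalD cevalM cevalX cevalC IHa !hornerE map_quat_alg scalerDl.
by rewrite -scalerAl mul1r scalerA.
Qed.

Lemma ceval_conjt p z : ceval (conjt p) z = quat_conj (ceval p z).
Proof.
elim/poly_ind: p => [|p c IHp]; first by rewrite !(raddf0, ceval0).
rewrite conjtD conjtM conjtC conjtX [LHS]cevalD (cevalM 'X) cevalX cevalC IHp.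
rewrite cevalD (cevalM p) cevalX cevalC quat_conjD quat_conjM quat_conj_alg.
by rewrite map_quat_conj.
Qed.

End ComplexEvaluation.

Lemma qnorm_eq0 (K : realFieldType) (x : quat K) : (qnorm x == 0) = (x == 0).
Proof.
apply/eqP/eqP => [|->]; last by rewrite /qnorm /= expr0n /= !addr0.
case: x => a b c d; rewrite /qnorm /=.
move/eqP; rewrite !paddr_eq0 ?addr_ge0 ?sqr_ge0 // !sqrf_eq0.
by move=> /andP[/andP[/andP[/eqP-> /eqP->] /eqP->] /eqP->].
Qed.

Lemma poly_size2 (K : nzRingType) (p : {poly K}) :
  (size p <= 2)%N -> p = (p`_1)%:P * 'X + (p`_0)%:P.
Proof.
move=> sp; apply/polyP=> -[|[|i]]; rewrite coefD coefMX !coefC /= ?add0r ?addr0 //.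
by rewrite nth_default // (leq_trans sp).
Qed.

Lemma linear_polyE (K : nzRingType) (a b c : K) :
  c * a = - b -> a%:P * 'X + b%:P = ('X - c%:P) * a%:P.
Proof. by move=> ca; rewrite mulrBl -polyCM ca polyCN opprK commr_polyX. Qed.

(** * From null values to linear factors *)

Section LinearFactors.
Variable R : realType.
Local Notation H := (quat R).
Local Notation rc := (real_complex R).
Implicit Types (p q : {poly H}) (z : R[i]).

Lemma ceval_hnorm p z :
  ceval (hnorm p) z = ceval p z * quat_conj (ceval p z).
Proof. by rewrite hnormE cevalM ceval_conjt. Qed.

(** At a real [z] the value would be a real quaternion, and only 0 has norm zero there. *)
Lemma null_point_nonreal p z :
  ceval p z != 0 -> ceval (hnorm p) z = 0 -> complex.Im z != 0.
Proof.
move=> pz; rewrite ceval_hnorm; apply: contra_eq_neq => z0.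
have zE : z%:A = map_quat rc (complex.Re z)%:A.
  rewrite map_quat_alg; congr (_ *: _).
  by apply/eqP; rewrite eq_complex /= eqxx z0 eqxx.
have E : ceval p z = map_quat rc p.[(complex.Re z)%:A].
  by rewrite /ceval zE horner_map.
rewrite E -map_quat_conj -rmorphM map_quat_eq0 mul_quat_conj quat_alg_eq0.
by rewrite qnorm_eq0 -map_quat_eq0 -E.
Qed.

Lemma linear_nonreal_root (a b : R) z :
  complex.Im z != 0 -> rc a * z + rc b = 0 -> a = 0 /\ b = 0.
Proof.
case: z => u v /= v0 /eqP; rewrite eq_complex /= !mul0r subr0 !addr0.
move=> /andP[/eqP ab]; rewrite mulf_eq0 (negPf v0) orbF => /eqP a0.
by move: ab; rewrite a0 mul0r add0r.
Qed.

Lemma ceval_linear (a b : H) z :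
  ceval (a%:P * 'X + b%:P) z = z *: map_quat rc a + map_quat rc b.
Proof.
rewrite cevalD; congr (_ + _); last exact: cevalC.
by rewrite cevalM cevalX cevalC mulr_algr.
Qed.

(** A nonreal [z] and 1 are linearly independent over the reals. *)
Lemma ceval_eq0_small p z :
  complex.Im z != 0 -> (size p <= 2)%N -> ceval p z = 0 -> p = 0.
Proof.
move=> z0 /poly_size2->; move: p`_1 p`_0 => [a b c d] [a' b' c' d'].
rewrite ceval_linear /map_quat !quatE => -[] /=.
rewrite ![z * _]mulrC => /(linear_nonreal_root z0)[-> ->].
move=> /(linear_nonreal_root z0)[-> ->] /(linear_nonreal_root z0)[-> ->].
move=> /(linear_nonreal_root z0)[-> ->].
by rewrite mul0r add0r.
Qed.

Lemma ceval_rdivp (x : H) p z :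
  ceval (hnorm ('X - x%:P)) z = 0 ->
  exists q r, [/\ p = q * hnorm ('X - x%:P) + r, (size r <= 2)%N &
    ceval p z = ceval r z].
Proof.
set m := hnorm _ => mz; have m1 : m \is monic by rewrite hnorm_monic ?monicXsubC.
exists (Pdiv.CommonRing.rdivp p m), (Pdiv.CommonRing.rmodp p m).
split; first exact: Pdiv.RingMonic.rdivp_eq.
  have : (size (Pdiv.CommonRing.rmodp p m) < size m)%N.
    by rewrite Pdiv.CommonRing.ltn_rmodp monic_neq0.
  by rewrite /m hnormE size_Mmonic ?conjt_monic ?monicXsubC ?polyXsubC_eq0 //
    size_conjt size_XsubC.
by rewrite {1}(Pdiv.RingMonic.rdivp_eq m1 p) cevalD cevalM mz mulr0 add0r.
Qed.

(** The norm of t - x is here the real minimal polynomial of [z]. *)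
Lemma dvd_hnorm_linear (x : H) p z :
  complex.Im z != 0 -> ceval (hnorm ('X - x%:P)) z = 0 -> ceval p z = 0 ->
  exists q, p = hnorm ('X - x%:P) * q.
Proof.
move=> z0 mz pz; have [q [r [pE sr]]] := ceval_rdivp p mz.
rewrite pz => /esym/(ceval_eq0_small z0 sr) r0.
by exists q; rewrite pE r0 addr0 hnormC.
Qed.

Lemma null_linear_poly z :
  exists x : H, ceval (hnorm ('X - x%:P)) z = 0.
Proof.
(* The norm polynomial is (t - u)^2 + v^2, with zeros z and its complex conjugate. *)
case: z => u v; exists (Quat u v 0 0).
rewrite ceval_hnorm mul_quat_conj cevalD cevalN cevalX cevalC /map_quat !quatE /=.
apply/eqP; rewrite quat_alg_eq0 /qnorm /= eq_complex; apply/andP; split; apply/eqP;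
  by rewrite /= ?(expr2, mulr0, mulr1, addr0, add0r, subr0, mul0r, oppr0, subrr) /=;
  rewrite ?mulrNN ?addNr.
Qed.

(* The remainder of p modulo the real quadratic polynomial with root z is      *)
(* linear, and its left zero is the required h.                                *)
Lemma left_linear_factor p z :
  ceval p z != 0 -> ceval (hnorm p) z = 0 ->
  exists (h : H) q, [/\ p = ('X - h%:P) * q, ceval (hnorm ('X - h%:P)) z = 0 &
    forall g, ceval (g * p) z = 0 -> ceval (g * ('X - h%:P)) z = 0].
Proof.
move=> pz npz; have z0 := null_point_nonreal pz npz.
have [x xz] := null_linear_poly z.
have [_ [r [_ sr rz]]] := ceval_rdivp p xz.
set a := r`_1; set b := r`_0.
have rE : r = a%:P * 'X + b%:P by exact: poly_size2.
have n0 (c : H) : c != 0 -> qnorm c != 0 by rewrite qnorm_eq0.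
(* Otherwise the value at [z] would be a real quaternion of norm zero, hence 0. *)
have a0 : a != 0.
  apply: contra_neq pz => a0; move: npz.
  rewrite ceval_hnorm rz rE a0 mul0r add0r cevalC -map_quat_conj -rmorphM.
  move/eqP; rewrite map_quat_eq0 mul_quat_conj quat_alg_eq0 qnorm_eq0.
  by move/eqP->; exact: raddf0.
pose a' := (qnorm a)^-1 *: quat_conj a.
have a'a : a' * a = 1.
  by rewrite -scalerAl mul_conj_quat scalerA mulVf ?n0 // scale1r.
have aa' : a * a' = 1.
  by rewrite -scalerAr mul_quat_conj scalerA mulVf ?n0 // scale1r.
pose h := - (b * a').
have {}rE : r = ('X - h%:P) * a%:P.
  by rewrite rE (@linear_polyE _ a b h) // /h mulNr -mulrA a'a mulr1.
(* At [z], [p] and t - h differ by the invertible right factor [a]. *)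
have E g : ceval (g * p) z = 0 -> ceval (g * ('X - h%:P)) z = 0.
  rewrite !cevalM rz rE cevalM cevalC => /(congr1 (fun y => y * map_quat rc a')).
  by rewrite mul0r -!mulrA -rmorphM aa' rmorph1 mulr1.
have hz : ceval (hnorm ('X - h%:P)) z = 0.
  have : ceval (conjt p * p) z = 0.
    by rewrite cevalM ceval_conjt mul_conj_quat -mul_quat_conj -ceval_hnorm.
  move/E; rewrite cevalM ceval_conjt rz rE cevalM cevalC quat_conjM -mulrA.
  move/(congr1 (fun y => quat_conj (map_quat rc a') * y)).
  rewrite mulr0 mulrA -quat_conjM -rmorphM aa' rmorph1 quat_conj1 mul1r => {}E.
  by rewrite ceval_hnorm mul_quat_conj -mul_conj_quat.
have [q pq] : exists q, p - r = hnorm ('X - h%:P) * q.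
  by apply: (dvd_hnorm_linear z0 hz); rewrite cevalD cevalN rz subrr.
exists h, (conjt ('X - h%:P) * q + a%:P); split => //.
by rewrite mulrDr -rE mulrA -hnormE -pq subrK.
Qed.

(** Take the left factor t - h of [p]. Then q^* (t - h) also vanishes at [z], so it is divisible by
    the norm of t - h, and [conj_left_factor] applies to [q]. *)
Lemma common_left_linear_factor p q z :
  ceval p z != 0 -> ceval (hnorm p) z = 0 -> ceval (conjt q * p) z = 0 ->
  exists (h : H) p' q', p = ('X - h%:P) * p' /\ q = ('X - h%:P) * q'.
Proof.
move=> pz npz qpz; have z0 := null_point_nonreal pz npz.
have [h [p' [pE hz /(_ _ qpz) qhz]]] := left_linear_factor pz npz.
have [g /(conj_left_factor (monicXsubC h)) qE] := dvd_hnorm_linear z0 hz qhz.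
by exists h, p', (conjt g).
Qed.

End LinearFactors.

Lemma join_is_lineP (R : realType) (x y : quat R[i]) :
  join_is_line x y <-> y != 0 /\ forall c, x <> c *: y.
Proof.
rewrite /join_is_line; have -> : (<[x]> + <[y]>)%VS = <<[:: x; y]>>%VS.
  by rewrite span_cons span_seq1.
rewrite (rwP eqP) -/(free [:: x; y]) free_cons span_seq1 seq1_free.
split=> [/andP[xy ->]|[-> xy]]; first split=> // c xE.
  by case/negP: xy; rewrite xE memvZ ?memv_line.
by rewrite andbT; apply/negP => /vlineP[c]; exact: xy.
Qed.

(** * Existence of a splitting and uniqueness of its left norm *)

Section Splitting.
Variable R : realType.
Local Notation H := (quat R).
Local Notation rc := (real_complex R).
Implicit Types (p q Q A B U W : {poly H}) (z : R[i]) (hs ks : seq H).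

(** Phrased through the norm of [Q1] instead of P, so that it passes to the cofactors when a common
    factor is removed. *)
Definition null_fibers_are_lines Q0 Q1 :=
  forall z, ceval (hnorm Q1) z = 0 -> join_is_line (ceval Q0 z) (ceval Q1 z).

Lemma hnorm_root p : p \is monic -> (1 < size p)%N ->
  exists z, ceval (hnorm p) z = 0.
Proof.
move=> p1 sp; have [a aE] := hnorm_real p.
have sa : size (map_poly rc a) != 1.
  rewrite size_map_poly -(size_map_poly (in_alg H) a) -/(real_poly a) -aE.
  rewrite hnormE size_Mmonic ?monic_neq0 ?conjt_monic // size_conjt.
  by case: (size p) sp => [|[|n]] // _; rewrite addnS.
have [z /rootP az] := closed_rootP _ sa.
by exists z; rewrite aE ceval_real az scale0r.
Qed.

(** The real norm form is anisotropic, so leading coefficients do not cancel and the norm doubles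
    the degree. *)
Lemma hnorm_constant p (c : H) : hnorm p = c%:P -> exists d, p = d%:P.
Proof.
move=> pc; exists p`_0; apply: size1_polyC.
have := size_polyC_leq1 c; rewrite -pc.
case: (eqVneq p 0) => [-> //|p0]; first by rewrite size_poly0.
rewrite hnormE size_proper_mul ?size_conjt; last first.
  rewrite {2}/lead_coef size_conjt coef_conjt mul_quat_conj quat_alg_eq0.
  by rewrite qnorm_eq0 lead_coef_eq0.
by case: (size p) => [|[|n]] //; rewrite addnS.
Qed.

(** Every term carries the central factor N(p), which cancels. In the mixed term p^* stands on the
    far side, but W U^* + U W^* is self-conjugate, hence real, and commutes with it. *)
Lemma split_left (p W U : {poly H}) (c0 c1 : H) :
  p \is monic ->
  hnorm (p * W) = c0%:P * hnorm (p * U) ->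
  p * W * conjt (p * U) + p * U * conjt (p * W) = c1%:P * hnorm (p * U) ->
  hnorm W = c0%:P * hnorm U /\ W * conjt U + U * conjt W = c1%:P * hnorm U.
Proof.
move=> p1; have np := hnorm_monic p1.
have E c : c%:P * hnorm (p * U) = hnorm p * (c%:P * hnorm U).
  by rewrite hnormM [RHS]mulrA (hnormC p c%:P) mulrA.
move=> n0 n1; have := etrans n0 (E c0); have S := etrans n1 (E c1).
rewrite (hnormM p W) => /(monic_mulrI np) ->; split=> //.
have [a aE] : exists a, W * conjt U + U * conjt W = real_poly a.
  by apply: conjt_fixed; rewrite conjtD !conjtM !conjtK addrC.
have XC := real_polyC (conjt p) a; rewrite -aE in XC.
apply: (monic_mulrI np); rewrite -S (conjtM p U) (conjtM p W) (hnormE p).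
by rewrite -[LHS]mulrA -XC mulrDl mulrDr !mulrA.
Qed.

Lemma split_right (p W U : {poly H}) (c0 c1 : H) :
  p \is monic ->
  hnorm (W * p) = c0%:P * hnorm (U * p) ->
  W * p * conjt (U * p) + U * p * conjt (W * p) = c1%:P * hnorm (U * p) ->
  hnorm W = c0%:P * hnorm U /\ W * conjt U + U * conjt W = c1%:P * hnorm U.
Proof.
move=> p1; have np := hnorm_monic p1.
have E c : c%:P * hnorm (U * p) = c%:P * hnorm U * hnorm p.
  by rewrite hnormM (mulrA c%:P).
have E' V V' : V * V' * hnorm p = V * p * (conjt p * V').
  by rewrite -[LHS]mulrA -hnormC hnormE !mulrA.
move=> n0 n1; have := etrans n0 (E c0); have S := etrans n1 (E c1).
rewrite (hnormM W p) => /(monic_mulIr np) ->; split=> //.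
apply: (monic_mulIr np); rewrite -S (conjtM U p) (conjtM W p) mulrDl.
by congr (_ + _); exact: E'.
Qed.

(** A linear dependence between the cofactors at [z] would survive multiplication by the value of
    [p]. *)
Lemma lines_left p W U :
  null_fibers_are_lines (p * W) (p * U) -> null_fibers_are_lines W U.
Proof.
move=> L z Uz; have /L/join_is_lineP : ceval (hnorm (p * U)) z = 0.
  by rewrite hnormM cevalM Uz mulr0.
rewrite !cevalM => -[pU pWU]; apply/join_is_lineP; split=> [|c W_].
  by apply: contraNneq pU => ->; rewrite mulr0.
by apply: (pWU c); rewrite W_ scalerAr.
Qed.

Lemma lines_right p W U :
  null_fibers_are_lines (W * p) (U * p) -> null_fibers_are_lines W U.
Proof.
move=> L z Uz; have /L/join_is_lineP : ceval (hnorm (U * p)) z = 0.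
  by rewrite hnormM cevalM Uz mul0r.
rewrite !cevalM => -[pU pWU]; apply/join_is_lineP; split=> [|c W_].
  by apply: contraNneq pU => ->; rewrite mul0r.
by apply: (pWU c); rewrite W_ scalerAl.
Qed.

Definition linear_prod hs : {poly H} := \prod_(x <- hs) ('X - x%:P).

Lemma exists_splitting Q0 Q1 (c0 c1 : H) :
  Q1 \is monic -> hnorm Q0 = c0%:P * hnorm Q1 ->
  Q0 * conjt Q1 + Q1 * conjt Q0 = c1%:P * hnorm Q1 ->
  null_fibers_are_lines Q0 Q1 ->
  exists hs h ks, Q1 = linear_prod hs * linear_prod ks /\
    Q0 = - (linear_prod hs * h%:P * linear_prod ks).
Proof.
have [n] := ubnP (size Q1); elim: n => // n IHn in Q0 Q1 * => sn m1 n0 n1 L.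
case: (leqP (size Q1) 1) => [s1|s1].
  have Q11 : Q1 = 1.
    move: m1; rewrite (size1_polyC s1) monicE lead_coefC => /eqP ->.
    by rewrite polyC1.
  have conj1 : conjt 1 = 1 :> {poly H} by rewrite -polyC1 conjtC quat_conj1.
  have h1 : hnorm 1 = 1 :> {poly H} by rewrite hnormE conj1 mulr1.
  (* With [Q1] = 1 the norm of [Q0] is constant, so [Q0] is a constant -h. *)
  move: n0; rewrite Q11 h1 mulr1.
  case/hnorm_constant=> d ->; exists [::], (- d), [::].
  rewrite /linear_prod !big_nil.
  split; first by rewrite mulr1.
  by rewrite mulr1 mul1r polyCN; exact/esym/opprK.
have [z Q1z] := hnorm_root m1 s1.
have /join_is_lineP[Q1z0 _] := L z Q1z.
have Q0z : ceval (hnorm Q0) z = 0 by rewrite n0 cevalM Q1z mulr0.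
have Q01z : ceval (Q0 * conjt Q1) z + ceval (Q1 * conjt Q0) z = 0.
  by rewrite -cevalD n1 cevalM Q1z mulr0.
case: (@null_line_ruling _ (ceval Q0 z) (ceval Q1 z)).
- by rewrite -ceval_hnorm.
- by rewrite -ceval_hnorm.
- by rewrite -!ceval_conjt -!cevalM.
(* Here q0 q1^* = 0: the conjugate polynomials share a left factor, whose conjugate is a common
   right factor to be appended to [ks]. *)
- rewrite -ceval_conjt -cevalM -{1}[Q0]conjtK => Qz.
  have [||h [U [W [Q1E Q0E]]]] := common_left_linear_factor _ _ Qz.
  + by rewrite ceval_conjt quat_conj_eq0.
  + by rewrite hnorm_conjt.
  pose p : {poly H} := 'X - (quat_conj h)%:P.
  have p1 : p \is monic by exact: monicXsubC.
  have {}Q1E : Q1 = conjt U * p by rewrite -[Q1]conjtK Q1E conjtM conjtXsubC.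
  have {}Q0E : Q0 = conjt W * p by rewrite -[Q0]conjtK Q0E conjtM conjtXsubC.
  move: (conjt U) (conjt W) Q1E Q0E => {}U {}W Q1E Q0E.
  move: m1 sn n0 n1 L; rewrite {}Q1E {}Q0E monicMr // => U1.
  rewrite size_Mmonic ?monic_neq0 // size_XsubC addn2 /= ltnS => sU.
  move=> n0 n1 L; have [m0 m1] := split_right p1 n0 n1.
  have [hs [g [ks [-> ->]]]] := IHn _ _ sU U1 m0 m1 (lines_right L).
  exists hs, g, (rcons ks (quat_conj h)).
  by rewrite /linear_prod -!cats1 !big_cat !big_seq1 /= mulNr !mulrA.
(* Here q0^* q1 = 0: the common left factor is put in front of [hs]. *)
- rewrite -ceval_conjt -cevalM => Qz.
  have [h [U [W [Q1E Q0E]]]] := common_left_linear_factor Q1z0 Q1z Qz.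
  pose p : {poly H} := 'X - h%:P.
  have p1 : p \is monic by exact: monicXsubC.
  move: m1 sn n0 n1 L; rewrite {}Q1E {}Q0E -/p monicMl // => U1.
  rewrite size_monicM ?monic_neq0 // size_XsubC /= ltnS => sU.
  move=> n0 n1 L; have [m0 m1] := split_left p1 n0 n1.
  have [hs [g [ks [-> ->]]]] := IHn _ _ sU U1 m0 m1 (lines_left L).
  exists (h :: hs), g, ks.
  by rewrite /linear_prod !big_cons mulrN !mulrA.
Qed.

(* A common zero would put both Q0(z) and Q1(z) into the intersection of two   *)
(* lines of opposite rulings.                                                  *)
Lemma left_right_norms_disjoint Q0 Q1 A B A' B' (h h' : H) z :
  null_fibers_are_lines Q0 Q1 ->
  Q1 = A * B -> Q0 = - (A * h%:P * B) ->
  Q1 = A' * B' -> Q0 = - (A' * h'%:P * B') ->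
  ceval (hnorm A) z = 0 -> ceval (hnorm B') z = 0 -> False.
Proof.
move=> L Q1E Q0E Q1E' Q0E' Az Bz.
have /L/join_is_lineP[Q1z Q01z] : ceval (hnorm Q1) z = 0.
  by rewrite Q1E hnormM cevalM Az mul0r.
have AAz : quat_conj (ceval A z) * ceval A z = 0.
  by rewrite mul_conj_quat -mul_quat_conj -ceval_hnorm.
have BBz : ceval B' z * quat_conj (ceval B' z) = 0 by rewrite -ceval_hnorm.
have [||||||Q1z'|[c Q0z]] :=
  @annihilators_collinear _ (quat_conj (ceval A z)) (quat_conj (ceval B' z))
    (ceval Q1 z) (ceval Q0 z).
- by rewrite quat_conj_eq0; apply: contraNneq Q1z; rewrite Q1E cevalM => ->; rewrite mul0r.
- by rewrite quat_conj_eq0; apply: contraNneq Q1z; rewrite Q1E' cevalM => ->; rewrite mulr0.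
- by rewrite Q1E cevalM mulrA AAz mul0r.
- by rewrite Q0E cevalN !cevalM mulrN !mulrA AAz !mul0r oppr0.
- by rewrite Q1E' cevalM -mulrA BBz mulr0.
- by rewrite Q0E' cevalN !cevalM mulNr -!mulrA BBz !mulr0 oppr0.
- by rewrite Q1z' eqxx in Q1z.
- exact: Q01z Q0z.
Qed.

(** Disjoint complex zero sets make N(A) coprime to N(B'), and N(A') to N(B). Gauss's lemma then
    gives mutual divisibility, and monicity turns it into equality. *)
Lemma left_norm_unique Q0 Q1 A B A' B' (h h' : H) :
  null_fibers_are_lines Q0 Q1 ->
  A \is monic -> A' \is monic ->
  Q1 = A * B -> Q0 = - (A * h%:P * B) ->
  Q1 = A' * B' -> Q0 = - (A' * h'%:P * B') ->
  hnorm A = hnorm A'.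
Proof.
move=> L A1 A1' Q1E Q0E Q1E' Q0E'.
have [a aE] := hnorm_real A; have [a' aE'] := hnorm_real A'.
have [b bE] := hnorm_real B; have [b' bE'] := hnorm_real B'.
have rM (C : {poly H}) c : C \is monic -> hnorm C = real_poly c -> c \is monic.
  move=> C1 cE; have := hnorm_monic C1; rewrite cE !monicE lead_coef_map.
  by move/eqP/(congr1 (@qre R)) => /=; rewrite mulr1 => ->.
have ab : a * b = a' * b'.
  apply: real_poly_inj; rewrite /real_poly !rmorphM /= -!/(real_poly _).
  by rewrite -aE -bE -aE' -bE' -!hnormM -Q1E -Q1E'.
have ceval0 C c z : hnorm C = real_poly c -> (map_poly rc c).[z] = 0 ->
    ceval (hnorm C) z = 0.
  by move=> -> cz; rewrite ceval_real cz scale0r.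
have co C c C' c' : hnorm C = real_poly c -> hnorm C' = real_poly c' ->
    (forall z, ceval (hnorm C) z = 0 -> ceval (hnorm C') z = 0 -> False) ->
    coprimep c c'.
  move=> cE cE' cc'; rewrite -(coprimep_map rc).
  apply: Pdiv.ClosedField.root_coprimep => z /rootP cz; apply/eqP => cz'.
  exact: (cc' z (ceval0 _ _ _ cE cz) (ceval0 _ _ _ cE' cz')).
have coab' := co _ _ _ _ aE bE' (fun z =>
  @left_right_norms_disjoint _ _ _ _ _ _ _ _ z L Q1E Q0E Q1E' Q0E').
have coa'b := co _ _ _ _ aE' bE (fun z =>
  @left_right_norms_disjoint _ _ _ _ _ _ _ _ z L Q1E' Q0E' Q1E Q0E).
rewrite aE aE'; congr real_poly; apply/eqP.
rewrite -eqp_monic ?(rM _ _ A1 aE) ?(rM _ _ A1' aE') // /eqp.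
rewrite -(Gauss_dvdpl _ coab') -ab dvdp_mulr //=.
by rewrite -(Gauss_dvdpl _ coa'b) ab dvdp_mulr.
Qed.

End Splitting.

(** * Translation between bivariate polynomials and pairs of coefficients *)

Lemma s_linear_inj (K : nzRingType) (a b c d : K) :
  a%:P + 'X * b%:P = c%:P + 'X * d%:P -> a = c /\ b = d.
Proof.
move=> /polyP E; move: (E 0%N) (E 1%N).
by rewrite !coefD !coefC !coefXM !coefC /= !addr0 !add0r => -> ->.
Qed.

Lemma coef_s_linearM (K : nzRingType) (a b c d : K) :
  let p := (a%:P + 'X * b%:P) * (c%:P + 'X * d%:P) in
  [/\ p`_0 = a * c, p`_1 = a * d + b * c & p`_2 = b * d].
Proof.
have -> : (a%:P + 'X * b%:P) * (c%:P + 'X * d%:P) =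
    (a * c)%:P + 'X * (a * d + b * c)%:P + 'X * ('X * (b * d)%:P).
  have XC (u v : K) : u%:P * ('X * v%:P) = 'X * (u * v)%:P.
    by rewrite mulrA commr_polyX -mulrA polyCM.
  rewrite mulrDl !mulrDr XC -!(mulrA 'X) XC -!polyCM polyCD mulrDr.
  by rewrite !addrA.
by split; rewrite !coefD !(coefC, coefXM) /= ?coefXM ?coefC /= ?addr0 ?add0r.
Qed.

Section Bivariate.
Variable R : realType.
Local Notation H := (quat R).
Implicit Types (hs ks : seq H) (A B Q : {poly H}).

Lemma prod_tfactor hs : \prod_(x <- hs) tfactor x = (linear_prod hs)%:P.
Proof. by rewrite /linear_prod rmorph_prod. Qed.

Lemma fact_prodE hs (h : H) ks :
  Defs.fact_prod (hs, h, ks) =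
    (- (linear_prod hs * h%:P * linear_prod ks))%:P +
    'X * (linear_prod hs * linear_prod ks)%:P.
Proof.
rewrite /Defs.fact_prod !prod_tfactor /sfactor; move: (linear_prod hs) (linear_prod ks).
move: h%:P => c A B.
by rewrite mulrBr mulrBl polyCN !polyCM addrC commr_polyX mulrA.
Qed.

Lemma factP (Q0 Q1 : {poly H}) hs h ks :
  fact (Q0%:P + 'X * Q1%:P) (hs, h, ks) <->
  Q1 = linear_prod hs * linear_prod ks /\
  Q0 = - (linear_prod hs * h%:P * linear_prod ks).
Proof.
change (Q0%:P + 'X * Q1%:P = Defs.fact_prod (hs, h, ks) <->
  Q1 = linear_prod hs * linear_prod ks /\
  Q0 = - (linear_prod hs * h%:P * linear_prod ks)).
by rewrite fact_prodE; split=> [/s_linear_inj[]|[<- <-]].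
Qed.

Lemma linear_prod_monic hs : linear_prod hs \is monic.
Proof. by apply: monic_prod => x _; exact: monicXsubC. Qed.

Lemma left_normE hs (h : H) ks : left_norm (hs, h, ks) = hnorm (linear_prod hs).
Proof.
rewrite /left_norm /= /linear_prod; elim: hs => [|x hs IHhs].
  by rewrite !big_nil hnormE -polyC1 conjtC quat_conj1 polyC1 mulr1.
by rewrite !big_cons hnormM IHhs [hnorm (_ - _)]hnormE.
Qed.

Lemma conjts_linear Q0 Q1 :
  conjts (Q0%:P + 'X * Q1%:P) = (conjt Q0)%:P + 'X * (conjt Q1)%:P.
Proof.
apply/polyP=> i; rewrite /conjts coef_map_id0 ?raddf0 // !coefD !coefXM !coefC.
by case: i => [|[|i]] /=; rewrite ?addr0 ?add0r ?raddf0.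
Qed.

Lemma coef_emb (P S : {poly R}) i :
  (emb_t P * emb_s S)`_i = real_poly P * ((S`_i)%:A)%:P.
Proof.
rewrite coefCM; congr (_ * _); apply: coef_map_id0.
by rewrite scale0r.
Qed.

End Bivariate.

Theorem corollary6p3 (R : realType) (Q0 Q1 : {poly (quat R)})
    (Q : {poly {poly (quat R)}}) (P S : {poly R}) :
  Q = Q0%:P + 'X * Q1%:P ->
  Q1 \is monic ->
  is_gcdts Q 1 ->
  Q * conjts Q = emb_t P * emb_s S ->
  (forall z : R[i], root (map_poly (real_complex R) P) z ->
     join_is_line (ceval Q0 z) (ceval Q1 z)) ->
  (fact_classes Q #= `I_1)%card.
Proof.
move=> -> Q1m _ QQ L.
have [E0 E1 E2] := coef_s_linearM Q0 Q1 (conjt Q0) (conjt Q1).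
(* Compare the coefficients of 1, s and s^2 in the norm equation. *)
have Ei i := congr1 (fun p : {poly {poly quat R}} => p`_i) QQ.
move: (Ei 0%N) (Ei 1%N) (Ei 2%N).
rewrite !coef_emb conjts_linear E0 E1 E2 -!hnormE => {E0 E1 E2 Ei}.
move: S`_0 S`_1 S`_2 => s0 s1 s2 n0 n01 n1.
have s2_neq0 : s2 != 0.
  apply: contraTneq (hnorm_monic Q1m) => s20.
  by rewrite n1 s20 scale0r mulr0 monicE lead_coef0 eq_sym oner_eq0.
(* The norm of [Q1] is P times the nonzero constant [s2], so its zeros are those of P. *)
have {}L : null_fibers_are_lines Q0 Q1.
  move=> z; rewrite n1 cevalM ceval_real cevalC map_quat_alg mulr_algl scalerA.
  move/eqP; rewrite quat_alg_eq0 mulf_eq0 => /orP[Pz|]; first exact: L.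
  by rewrite fmorph_eq0 (negPf s2_neq0).
(* Dividing by [s2] writes the other coefficients as constant multiples of the norm of [Q1], the
   form that the induction preserves. *)
have normalize s : real_poly P * (s%:A)%:P = ((s / s2)%:A)%:P * hnorm Q1.
  have -> : s%:A = (s / s2)%:A * s2%:A :> quat R.
    by rewrite -scalerAl mul1r scalerA divfK.
  rewrite n1 polyCM; move: ((s / s2)%:A%:P) ((s2%:A)%:P) => c d.
  by rewrite (mulrA _ c) (real_polyC c) -[LHS]mulrA.
have [hs [h [ks [Q1E Q0E]]]] :=
  exists_splitting Q1m (etrans n0 (normalize _)) (etrans n01 (normalize _)) L.
have Qf : fact (Q0%:P + 'X * Q1%:P) (hs, h, ks) by apply/factP.
set F := Q0%:P + 'X * Q1%:P in Qf *.
suff -> : fact_classes F = [set fact_class F (hs, h, ks)]%classic.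
  exact: card_set1.
have same_norm f g : fact F f -> fact F g -> left_norm f = left_norm g.
  case: f g => [[fs f] fs'] [[gs g] gs'] /factP[f1 f0] /factP[g1 g0].
  rewrite !left_normE.
  exact: (left_norm_unique L (linear_prod_monic _) (linear_prod_monic _) f1 f0 g1 g0).
apply/seteqP; split=> [_ [f Qf' <-]|_ ->]; last by exists (hs, h, ks).
by apply/seteqP; split=> g [Qg _]; split=> //; exact: same_norm.
Qed.
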